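(* Let $P$ be a finite poset with a greatest element $\hat{1}$. Then a closure relation $H$ on $P$ is a modular element of the lattice $LC(P)$ if and only if $H$ satisfies the following cover property: for all $x,y\in P$, if $y$ covers $x$ and $H(x)\neq x$, then $H(y)=H(x)$.
   Context: A closure relation on a poset $P$ is a map $H:P\to P$ such that for all $x,y\in P$: (1) $x\le H(x)$; (2) $x\le y$ implies $H(x)\le H(y)$; (3) $H(H(x))=H(x)$. $LC(P)$ is the lattice of all closure relations on $P$, ordered by $H\le K$ if and only if $H(x)\le K(x)$ for all $x\in P$. An element $H$ of a lattice $L$ is modular if and only if for all $K\le K'$ in $L$, the equalities $H\vee K=H\vee K'$ and $H\wedge K=H\wedge K'$ together imply $K=K'$. *)

(* Defs.v *)
From HB Require Import structures.
From mathcomp Require Import all_boot all_order.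

Set Implicit Arguments.
Unset Strict Implicit.
Unset Printing Implicit Defensive.

Import Order.TTheory.
Local Open Scope order_scope.

(* covers x y: y covers x *)
Definition covers d (P : porderType d) (x y : P) : Prop :=
  x < y /\ ~ exists z : P, x < z /\ z < y.

Definition modular_element d (L : latticeType d) (H : L) : Prop :=
  forall K K' : L, K <= K' ->
    H `|` K = H `|` K' -> H `&` K = H `&` K' -> K = K'.

Definition is_closure d (P : finPOrderType d) (f : {ffun P -> P}) : bool :=
  [&& [forall x, x <= f x],
      [forall x, forall y, (x <= y) ==> (f x <= f y)] &
      [forall x, f (f x) == f x]].

Record LC d (P : finPOrderType d) : Type := ClosureRelation {
  closure_fun :> {ffun P -> P};
  closure_funP : is_closure closure_fun
}.

HB.instance Definition _ d (P : finPOrderType d) :=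
  [isSub for @closure_fun d P].
HB.instance Definition _ d (P : finPOrderType d) := [Finite of LC P by <:].

Section ClosureLattice.
Context {d : Order.disp_t} {P : finPOrderType d}.
Implicit Types (x y z : P) (H K L : LC P).

Lemma is_closureP (f : {ffun P -> P}) :
  reflect [/\ forall x, x <= f x,
              forall x y, x <= y -> f x <= f y &
              forall x, f (f x) = f x]
          (is_closure f).
Proof.
apply: (iffP and3P) => [[/forallP f1 /forallP f2 /forallP f3]|[f1 f2 f3]].
  split=> // [x y xy|x]; last exact/eqP.
  by move/forallP/(_ y)/implyP: (f2 x); apply.
split; apply/forallP=> x //; last exact/eqP.
by apply/forallP=> y; apply/implyP; apply: f2.
Qed.

Lemma closure_ext H x : x <= H x.
Proof. by have /is_closureP[] := closure_funP H. Qed.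

Lemma closure_mono H x y : x <= y -> H x <= H y.
Proof. by have /is_closureP[_ Hm _] := closure_funP H; apply: Hm. Qed.

Lemma closure_idem H x : H (H x) = H x.
Proof. by have /is_closureP[] := closure_funP H. Qed.

Lemma closure_eqP H K : (forall x, H x = K x) -> H = K.
Proof. by move=> HK; apply/val_inj/ffunP. Qed.

Definition le_closure H K := [forall x, H x <= K x].

Fact le_closure_refl : reflexive le_closure.
Proof. by move=> H; apply/forallP. Qed.

Fact le_closure_anti : antisymmetric le_closure.
Proof.
move=> H K /andP[/forallP HK /forallP KH]; apply: closure_eqP => x.
by apply/le_anti; rewrite HK KH.
Qed.

Fact le_closure_trans : transitive le_closure.
Proof.
move=> K H L /forallP HK /forallP KL; apply/forallP => x.
exact: le_trans (HK x) (KL x).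
Qed.

HB.instance Definition _ := @Order.Le_isPOrder.Build d (LC P) le_closure
  le_closure_refl le_closure_anti le_closure_trans.

Lemma leLCP H K : reflect (forall x, H x <= K x) (H <= K).
Proof. exact: forallP. Qed.

Fact bot_closure_subproof : is_closure [ffun x : P => x].
Proof. by apply/is_closureP; split=> [x|x y|x]; rewrite !ffunE. Qed.

Definition bot_closure : LC P := ClosureRelation bot_closure_subproof.

Fact bot_closure_le H : bot_closure <= H.
Proof. by apply/leLCP => x; rewrite ffunE closure_ext. Qed.

HB.instance Definition _ :=
  @Order.hasBottom.Build d (LC P) bot_closure bot_closure_le.

(* A composite of two closure relations need not be idempotent; its iterates
   stabilize after at most #|P| steps, as P has no longer chain. *)
Definition join_closure_fun H K : {ffun P -> P} :=
  [ffun x => iter #|P| (fun z => K (H z)) x].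

Lemma iter_fix (f : P -> P) x : (forall z, z <= f z) ->
  f (iter #|P| f x) = iter #|P| f x.
Proof.
move=> f_ext; pose up y := [set z | y <= z].
suff /(_ #|P|) [//|] : forall n,
    f (iter n f x) = iter n f x \/ (#|up (iter n f x)| + n <= #|P|)%N.
  rewrite -[leqRHS]add0n leq_add2r leqn0 cards_eq0 => /eqP u0.
  by have := in_set0 (iter #|P| f x); rewrite -u0 inE lexx.
elim=> [|n [fx|IHn]]; [by right; rewrite addn0 max_card|by left; rewrite /= !fx|].
have [fx|fx] := eqVneq (f (iter n f x)) (iter n f x); first by left; rewrite /= !fx.
right; rewrite addnS -addSn; apply: leq_trans IHn.
rewrite leq_add2r proper_card //; apply/properP; split.
  by apply/subsetP => z; rewrite !inE; apply: le_trans (f_ext _).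
exists (iter n f x); rewrite !inE ?lexx //=.
by apply: contra fx => le_fx; rewrite eq_le le_fx f_ext.
Qed.

Fact join_closure_subproof H K : is_closure (join_closure_fun H K).
Proof.
set f := fun z => K (H z).
have f_ext z : z <= f z by apply: le_trans (closure_ext _ _); apply: closure_ext.
have f_mono x y : x <= y -> f x <= f y by move=> xy; do 2!apply: closure_mono.
apply/is_closureP; split=> [x|x y xy|x]; rewrite !ffunE -/f.
- by elim: #|P| => //= n IHn; apply: le_trans IHn (f_ext _).
- by elim: #|P| => //= n IHn; apply: f_mono.
by elim: {1}#|P| => //= n ->; apply: iter_fix.
Qed.

Definition join_closure H K : LC P :=
  ClosureRelation (join_closure_subproof H K).

Fact join_closureP H K L : (join_closure H K <= L) = (H <= L) && (K <= L).
Proof.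
set f := fun z => K (H z).
have f_ext z : z <= f z by apply: le_trans (closure_ext _ _); apply: closure_ext.
have iter_ext n x : x <= iter n f x.
  by elim: n => //= n IHn; apply: le_trans IHn (f_ext _).
apply/leLCP/andP => [JL|[/leLCP HL /leLCP KL] x].
  have fL x : f x <= L x.
    apply: le_trans (JL x); rewrite ffunE -/f -iter_fix //.
    by apply/closure_mono/closure_mono/iter_ext.
  split; apply/leLCP => x; apply: le_trans (fL x); first exact: closure_ext.
  by apply: closure_mono; apply: closure_ext.
rewrite ffunE -/f; elim: #|P| => [|n IHn]; first exact: closure_ext.
rewrite /= -[L x]closure_idem; apply: le_trans (KL _).
apply: closure_mono; rewrite -[L x]closure_idem; apply: le_trans (HL _).
exact: closure_mono.
Qed.

HB.instance Definition _ :=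
  @Order.POrder_isJoinSemilattice.Build d (LC P) join_closure join_closureP.

(* Meets in P need not exist, so the meet of two closure relations is not
   pointwise; it is the join of their common lower bounds. *)
Definition meet_closure H K : LC P :=
  \join_(L : LC P | (L <= H) && (L <= K)) L.

Fact meet_closureP H K L : (H <= meet_closure K L) = (H <= K) && (H <= L).
Proof.
apply/idP/idP => [HM|HKL]; last exact: (@joins_sup _ _ _ H).
apply/andP; split; apply: (le_trans HM); apply/joinsP => J /andP[]//.
Qed.

HB.instance Definition _ :=
  @Order.POrder_isMeetSemilattice.Build d (LC P) meet_closure meet_closureP.

End ClosureLattice.

Definition cover_property d (P : finPOrderType d) (H : LC P) : Prop :=
  forall x y : P, covers x y -> H x <> x -> H y = H x.

(* Main.v *)
Require Import Defs.
From mathcomp Require Import all_boot all_order.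

(** A closure relation is determined by its closed (i.e. fixed) points, larger
    closures having fewer of them; the closed points of [H `|` K] are exactly
    those common to [H] and [K].

    Suppose that [H] has the cover property. Climbing from a point [x] that is
    not closed, one cover at a time, the value of [H] stays constant until
    [H x] itself is reached; hence everything above [x] is comparable with
    [H x] ([cover_property_comparable]). It follows that [H x] and [K x] are
    always comparable, so that [H] and [K] have a pointwise minimum, which is
    a closure ([min_closure_subproof]) below both. Let now [K <= K'] have the
    same join and the same meet with [H], and let [x] be closed under [K]. If
    [H x = x], equality of the joins makes [x] closed under [K']. Otherwise
    equality of the meets gives that [x], which is closed under the meet, is
    the smaller of [H x] and [K' x], hence equals [K' x]. So [K'] has
    the same closed points as [K].

    Conversely, let [y] cover [x] with [H x <> x] and [H y <> H x], so that
    [y] is not below [H x]. Take for [K'] and [K] the closures whose closed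
    points are [y, \top] and [x, y, \top]. The additional closed point [x] of
    [K] is not closed under [H], so the joins with [H] agree. The meet of [H]
    and [K'] sends [x] below both [H x] and [y]; as nothing lies strictly
    between [x] and [y], it fixes [x], so it is also below [K]: the meets
    agree, although [K x = x] and [K' x = y]. *)

Set Implicit Arguments.
Unset Strict Implicit.
Unset Printing Implicit Defensive.

Import Order.TTheory.
Local Open Scope order_scope.

Section Closures.
Context {d : Order.disp_t} {P : finPOrderType d}.
Implicit Types (x y z w : P) (H K J F : LC P).

Lemma le_closure_fix K J z : K <= J -> K (J z) = J z.
Proof.
move=> /leLCP KJ; apply: le_anti; rewrite closure_ext andbT.
by rewrite -{2}(closure_idem J z).
Qed.

(** [K' x] is at most any [K']-closed point above [x], such as [K x]. *)
Lemma le_closure_of_fix K K' : (forall x, K x = x -> K' x = x) -> K' <= K.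
Proof.
move=> fixK; apply/leLCP => x; rewrite -(fixK (K x)) ?closure_idem //.
exact/closure_mono/closure_ext.
Qed.

Lemma join_closure_fix H K x : H x = x -> K x = x -> (H `|` K) x = x.
Proof.
move=> Hx Kx; have -> : H `|` K = join_closure H K by [].
by rewrite ffunE; elim: #|P| => //= n ->; rewrite Hx.
Qed.

Lemma exists_cover_le x y : x < y -> exists2 z, covers x z & z <= y.
Proof.
move=> xy; have xyy : (x < y) && (y <= y) by rewrite xy lexx.
case: (@arg_minnP _ y (fun z => (x < z) && (z <= y))
  (fun z => #|[set t | t < z]|) xyy) => z /andP[xz zy] zmin.
exists z => //; split=> // -[t [xt tz]].
have := zmin t; rewrite xt (le_trans (ltW tz) zy) => /(_ isT).
rewrite leqNgt => /negP; apply; apply/proper_card/properP; split.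
  by apply/subsetP => u; rewrite !inE => /lt_trans; apply.
by exists t; rewrite inE // ltxx.
Qed.

(** The induction is on the number of points above [x]: either a cover [z <= y]
    of [x] is closed, and then [z = H z = H x], or it replaces [x], and [H z = H x]. *)
Lemma cover_property_comparable H x y :
  cover_property H -> H x != x -> x <= y -> H x >=< y.
Proof.
move=> cH; have [n] := ubnP #|[set t | x <= t]|.
elim: n x => // n IHn x lt_n Hx; rewrite le_eqVlt => /predU1P[<-|].
  by rewrite /Order.comparable closure_ext orbT.
case/exists_cover_le=> z xz zy; have Hzx := cH x z xz (elimN eqP Hx).
have [Hz|Hz] := eqVneq (H z) z; first by rewrite -Hzx Hz le_comparable.
rewrite -Hzx; apply: IHn => //; case: xz => xz _.
apply: leq_trans (lt_n : (_ <= n)%N); apply/proper_card/properP; split.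
  by apply/subsetP => t; rewrite !inE; apply: le_trans (ltW xz).
by exists x; rewrite !inE ?lexx // (lt_geF xz).
Qed.

(** A pointwise minimum of closures has the universal property of a binary meet
    in the poset at each point, from which the closure axioms follow formally. *)
Lemma min_closure_subproof H K : (forall x, H x >=< K x) ->
  is_closure [ffun x => Order.min (H x) (K x)].
Proof.
move=> HK; have le_min w x : (w <= Order.min (H x) (K x)) = (w <= H x) && (w <= K x).
  exact: comparable_le_min.
have [minH minK] : (forall x, Order.min (H x) (K x) <= H x) /\
    (forall x, Order.min (H x) (K x) <= K x).
  by split=> x; have := le_min (Order.min (H x) (K x)) x; rewrite lexx => /esym/andP[].
apply/is_closureP; split=> [x|x y xy|x]; rewrite !ffunE.
- by rewrite le_min !closure_ext.
- rewrite le_min (le_trans (minH x)) ?closure_mono //=.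
  by rewrite (le_trans (minK x)) ?closure_mono.
apply: le_anti; rewrite !le_min !closure_ext !andbT.
rewrite (le_trans (minH _)) /=.
  by rewrite (le_trans (minK _)) // -{2}(closure_idem K x) closure_mono.
by rewrite -{2}(closure_idem H x) closure_mono.
Qed.

Lemma meet_closureE H K x : (forall z, H z >=< K z) ->
  (H `&` K) x = Order.min (H x) (K x).
Proof.
move=> HK; pose M := ClosureRelation (min_closure_subproof HK).
have /leLCP/(_ x) : M <= H `&` K.
  by rewrite lexI; apply/andP; split; apply/leLCP => z;
    rewrite ffunE comparable_ge_min // lexx ?orbT.
have /leLCP/(_ x) HKH : H `&` K <= H by apply: leIl.
have /leLCP/(_ x) HKK : H `&` K <= K by apply: leIr.
rewrite ffunE => Mle; apply: le_anti; rewrite Mle andbT.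
by rewrite comparable_le_min // HKH.
Qed.

Lemma cover_property_modular H : cover_property H -> modular_element H.
Proof.
move=> cH K K' KK' eqU eqI; apply: le_anti; rewrite KK' /=.
apply: le_closure_of_fix => x Kx.
have cmpHK' z : H z >=< K' z.
  have [->|Hz] := eqVneq (H z) z; first by rewrite le_comparable ?closure_ext.
  exact: cover_property_comparable (closure_ext _ _).
have [Hx|Hx] := eqVneq (H x) x.
  have Jx := join_closure_fix Hx Kx.
  by rewrite -Jx le_closure_fix // eqU leUr.
have : (H `&` K') x = x.
  apply: le_anti; rewrite closure_ext andbT -eqI -{2}Kx.
  by apply/leLCP; apply: leIr.
rewrite meet_closureE // minEle; case: ifP => // _ Hx'.
by rewrite Hx' eqxx in Hx.
Qed.

(** Adding a closed point [x] to those of [F] gives a closure as soon as [x] is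
    below every closed point of [F]: the least closed point above [z] is then
    [x] if [z <= x], and is otherwise unchanged. *)
Lemma add_closed_subproof F x : (forall z, x <= F z) ->
  is_closure [ffun z => if z <= x then x else F z].
Proof.
move=> xF; apply/is_closureP; split=> [z|z w zw|z]; rewrite !ffunE.
- by case: ifP => // _; apply: closure_ext.
- case: ifP => [zx|/negP zx]; first by case: ifP.
  case: ifP => [wx|_]; first by case: zx; apply: le_trans wx.
  exact: closure_mono.
case: (boolP (z <= x)) => [_|zx]; first by rewrite lexx.
case: ifP => [Fzx|_]; last exact: closure_idem.
by rewrite (le_trans (closure_ext F z) Fzx) in zx.
Qed.

Definition add_closed F x (xF : forall z, x <= F z) : LC P :=
  ClosureRelation (add_closed_subproof xF).

Lemma add_closed_le F x (xF : forall z, x <= F z) : add_closed xF <= F.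
Proof. by apply/leLCP => z; rewrite ffunE; case: ifP. Qed.

(** Adding a closed point [x] that is not closed under [H] does not change the
    join with [H], as the closed points of a join are those common to both. *)
Lemma join_add_closed H F x (xF : forall z, x <= F z) :
  H x != x -> H `|` add_closed xF = H `|` F.
Proof.
move=> Hx; apply: le_anti; rewrite leU2 ?add_closed_le //= leUx leUl /=.
apply: le_closure_of_fix => z Jz.
have Hz : H z = z by rewrite -Jz le_closure_fix // leUl.
have : add_closed xF z = z by rewrite -Jz le_closure_fix // leUr.
by rewrite ffunE; case: ifP => // _ xz; rewrite xz Hz eqxx in Hx.
Qed.

(** Adding [x] only lowers the values at points below [x], from [F z] to [x];
    a closure fixing [x] respects this lower bound anyway. *)
Lemma meet_add_closed H F x (xF : forall z, x <= F z) :
  (H `&` F) x = x -> H `&` add_closed xF = H `&` F.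
Proof.
move=> Mx; apply: le_anti; rewrite leI2 ?add_closed_le //= lexI leIl /=.
apply/leLCP => z; rewrite ffunE; case: ifP => [zx|_].
  by rewrite -[leRHS]Mx closure_mono.
by apply/leLCP; apply: leIr.
Qed.

End Closures.

Section WithTop.
Context {d : Order.disp_t} {P : finTPOrderType d}.
Implicit Types (x y z : P) (H : LC P).

Lemma top_closure_subproof : is_closure [ffun _ : P => \top : P].
Proof. by apply/is_closureP; split=> [x|x y _|x]; rewrite !ffunE ?lex1. Qed.

Definition top_closure : LC P := ClosureRelation top_closure_subproof.

Lemma le_top_closure y z : y <= top_closure z.
Proof. by rewrite ffunE lex1. Qed.

Lemma modular_cover_property H : modular_element H -> cover_property H.
Proof.
move=> modH x y [xy no_between] /eqP Hx; apply/eqP.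
have [yHx|yHx] := boolP (y <= H x).
  (* The cover property holds at once: [H y] lies between [H x] and [H (H x)]. *)
  by rewrite eq_le -{1}(closure_idem H x) !closure_mono // ltW.
pose K' := add_closed (le_top_closure y).
have xK' z : x <= K' z by rewrite ffunE; case: ifP; rewrite ?(ltW xy) ?le_top_closure.
have K'x : K' x = y by rewrite ffunE ltW.
pose K := add_closed xK'.
have Kx : K x = x by rewrite ffunE lexx.
suff KK' : K = K' by rewrite -K'x -KK' Kx ltxx in xy.
apply: modH; [exact: add_closed_le|exact: join_add_closed|apply: meet_add_closed].
set M := H `&` K'.
have MH : M x <= H x by apply/leLCP; apply: leIl.
have My : M x <= y by rewrite -K'x; apply/leLCP; apply: leIr.
have M_ne_y : M x != y by apply: contraNneq yHx => <-.
apply/eqP/contraT => Mx; case: no_between; exists (M x).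
by rewrite !lt_neqAle My M_ne_y closure_ext eq_sym Mx.
Qed.

End WithTop.

Theorem theorem9 (d : Order.disp_t) (P : finTPOrderType d) (H : LC P) :
  modular_element H <-> cover_property H.
Proof.
split; [exact: modular_cover_property|exact: cover_property_modular].
Qed.
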